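(* Let $V$ be a finite set with $N\ge1$ elements, let $R\ge1$, let $F_1,\dots,F_R:2^V\to\mathbb R$ be submodular with $F_r(\emptyset)=0$ for all $r$, and let $F=\sum_{r=1}^R F_r$ with Lovász extension $f$. Let $\mathcal A=\{(a_1,\dots,a_R)\in\mathbb R^{NR} : \sum_{r=1}^R a_r=0\}$ and $\mathcal B=B(F_1)\times\cdots\times B(F_R)$. Let $a_0\in\mathcal A$ and let $b_k=\Pi_{\mathcal B}a_k$, $a_{k+1}=\Pi_{\mathcal A}b_k$ for $k\ge0$; let $(a_*,b_* )$ be the limit of $(a_k,b_k)$, which is a minimizer of $\|a-b\|^2$ over $\mathcal A\times\mathcal B$. Set $x_k=\Gamma b_k$ and $x_*=\Gamma b_*$, where $\Gamma:\mathbb R^{NR}\to\mathbb R^N$, $\Gamma(w_1,\dots,w_R)=-\sum_{r=1}^R w_r$. Then $f(x_k)+\frac12\|x_k\|^2\to f(x_* )+\frac12\|x_*\|^2$ linearly with rate $1-\frac{1}{N^2R^2}$; that is, there is a constant $C$ such that for all $k\ge0$ $$\Bigl|\bigl(f(x_k)+\tfrac12\|x_k\|^2\bigr)-\bigl(f(x_* )+\tfrac12\|x_*\|^2\bigr)\Bigr|\le C\Bigl(1-\frac{1}{N^2R^2}\Bigr)^k .$$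
   Context: A set function $F:2^V\to\mathbb R$ is submodular if $F(A)+F(B)\ge F(A\cup B)+F(A\cap B)$ for all $A,B\subseteq V$. A vector $s\in\mathbb R^N=\mathbb R^V$ is identified with the modular set function $s(A)=\sum_{n\in A}s_n$. The base polytope of $F$ is $B(F)=\{s\in\mathbb R^N : s(A)\le F(A)\text{ for all }A\subseteq V,\ s(V)=F(V)\}$, and the Lovász extension of $F$ is $f(x)=\max_{s\in B(F)}s^\top x$ for $x\in\mathbb R^N$. $\Pi_C z$ denotes the Euclidean projection of $z$ onto a nonempty closed convex set $C$; $\|\cdot\|$ is the Euclidean norm. The point $x_*$ is the minimizer of $f(x)+\frac12\|x\|^2$ over $\mathbb R^N$. Convention $0^0=1$. *)

(* Defs.v *)
From mathcomp Require Import all_boot all_order all_algebra.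
From mathcomp Require Import all_classical all_reals all_analysis.

Set Implicit Arguments.
Unset Strict Implicit.
Unset Printing Implicit Defensive.

Import Order.TTheory GRing.Theory Num.Theory.
Import numFieldNormedType.Exports.

Local Open Scope classical_set_scope.
Local Open Scope ring_scope.

(* For a finite type I, the Euclidean space R^I is {ffun I -> K}, K a realType.
   In particular R^N = R^V is {ffun V -> K} with N = #|V|, and R^(NR) is
   {ffun 'I_R * V -> K}, the r-th block of w being v |-> w (r, v). *)

Section Euclidean.
Context {K : realType} {I : finType}.

Definition dot (x y : {ffun I -> K}) : K := \sum_i x i * y i.

(* The library's own norms on finite products are sup norms. *)
Definition enorm (x : {ffun I -> K}) : K := Num.sqrt (dot x x).

(* p is the Euclidean projection of z onto C; for C nonempty, closed and convex
   there is exactly one such p. *)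
Definition is_proj (C : set {ffun I -> K}) (z p : {ffun I -> K}) : Prop :=
  C p /\ forall q, C q -> enorm (z - p) <= enorm (z - q).

End Euclidean.

Section Submodular.
Context {K : realType} {V : finType}.

Definition submodular (F : {set V} -> K) : Prop :=
  forall A B : {set V}, F (A :|: B) + F (A :&: B) <= F A + F B.

Definition modular (s : {ffun V -> K}) (A : {set V}) : K := \sum_(v in A) s v.

Definition base_polytope (F : {set V} -> K) : set {ffun V -> K} :=
  [set s | (forall A : {set V}, modular s A <= F A) /\
           modular s finset.setT = F finset.setT].

(* When F is submodular with F(empty) = 0, base_polytope F is nonempty and
   compact, so this supremum is the maximum. *)
Definition lovasz (F : {set V} -> K) (x : {ffun V -> K}) : K :=
  sup [set dot s x | s in base_polytope F].

End Submodular.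

Section Blocks.
Context {K : realType} {V : finType} {R : nat}.

Definition block (w : {ffun 'I_R * V -> K}) (r : 'I_R) : {ffun V -> K} :=
  [ffun v => w (r, v)].

Definition sum_zero_space : set {ffun 'I_R * V -> K} :=
  [set a | \sum_(r < R) block a r = 0].

Definition prod_base (F : 'I_R -> {set V} -> K) : set {ffun 'I_R * V -> K} :=
  [set b | forall r, base_polytope (F r) (block b r)].

Definition Gamma (w : {ffun 'I_R * V -> K}) : {ffun V -> K} :=
  - \sum_(r < R) block w r.

End Blocks.

(* Main.v *)
Require Import Defs.
From mathcomp Require Import all_boot all_order all_algebra.
From mathcomp Require Import all_classical all_reals all_analysis.
From mathcomp Require Import ring lra.

(** Write [A] for the sum-zero space, [B] for the product of the base polytopes,
    and [s] for the point of least norm among the block sums of points of [B]; it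
    is characterized by [<s, s' - s> >= 0] for all other block sums [s'].  The
    distance of [b] in [B] to [A] is the norm of its block sum divided by
    [sqrt R], so the points of [B] nearest to [A] are those of the fiber
    [H = {h in B | block_sum h = s}], and [h - spread s], with [s / R] in each
    block of [spread s], is the nearest point of [A].

    Convergence is linear because of two facts.  The first is a Fejer inequality
    ([alternating_step_fejer]): one iteration decreases the squared distance to
    each [h] of [H] by at least [|s - block_sum b|^2 / R].  The second is an error
    bound ([fiber_error_bound]): the squared distance of [b] to [H] is at most
    [N^2 R / 4 * |s - block_sum b|^2].  Together they give
    [dist(b_{k+1}, H)^2 <= (1 - 4 / (N^2 R^2)) dist(b_k, H)^2], and the factor is
    at most [(1 - 1 / (N^2 R^2))^2].

    The error bound is combinatorial.  Let [h] be the point of [H] nearest to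
    [b], and [d = h - b].  Join [v] to [u] when, in some block [r], [d] is
    negative at [v] and positive at [u], and mass can be moved from [u] to [v]
    inside the base polytope starting from [h].  This graph has no cycle
    ([exchange_acyclic]): the exchanges along a cycle preserve the block sum and
    would bring [h] closer to [b].  For a set [W] that no edge leaves,
    submodularity, through unions and intersections of tight sets, shows that [d]
    has nonnegative total on [W] in every block ([closed_set_ge0]), whereas the
    totals over all blocks add up to the total of [s - block_sum b] on [W], which
    is at most half its 1-norm.  Taking for [W] the points reached from a given
    [u], or those that do not lead to [u], bounds each coordinate of [d] by half
    the 1-norm of [s - block_sum b] ([displacement_le]).

    Finally the projections of [b_k] onto [H] form a Cauchy sequence, whose limit
    is [b_*], and the objective is Lipschitz on the opposite of the base polytope
    of [F] ([objective_lipschitz]), so the rate for [block_sum b_k] carries over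
    to the objective values. *)

Set Implicit Arguments.
Unset Strict Implicit.
Unset Printing Implicit Defensive.

Import Order.TTheory GRing.Theory Num.Theory.
Import numFieldNormedType.Exports.

Local Open Scope classical_set_scope.
Local Open Scope ring_scope.

(** * Inner products and projections *)

Section Euclid.
Context {K : realType} {I : finType}.
Implicit Types (x y z p q : {ffun I -> K}) (C : set {ffun I -> K}).

Lemma dotC x y : dot x y = dot y x.
Proof. by apply: eq_bigr => i _; rewrite mulrC. Qed.

Lemma dotDl x y z : dot (x + y) z = dot x z + dot y z.
Proof. by rewrite -big_split; apply: eq_bigr => i _; rewrite ffunE mulrDl. Qed.

Lemma dotZl t x y : dot (t *: x) y = t * dot x y.
Proof. by rewrite mulr_sumr; apply: eq_bigr => i _; rewrite ffunE mulrA. Qed.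

Lemma dotNl x y : dot (- x) y = - dot x y.
Proof. by rewrite -scaleN1r dotZl mulN1r. Qed.

Lemma dotDr x y z : dot z (x + y) = dot z x + dot z y.
Proof. by rewrite dotC dotDl !(dotC z). Qed.

Lemma dotZr t x y : dot x (t *: y) = t * dot x y.
Proof. by rewrite dotC dotZl dotC. Qed.

Lemma dotNr x y : dot x (- y) = - dot x y.
Proof. by rewrite dotC dotNl dotC. Qed.

Definition dotE := (dotDl, dotDr, dotNl, dotNr, dotZl, dotZr).

Lemma dot_ge0 x : 0 <= dot x x.
Proof. by apply: sumr_ge0 => i _; rewrite -expr2 sqr_ge0. Qed.

Lemma dot_le0_eq0 x : dot x x <= 0 -> x = 0.
Proof.
move=> x0; have /eqP : dot x x = 0 by apply/eqP; rewrite eq_le x0 dot_ge0.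
rewrite psumr_eq0 => [/allP xx|i _]; last by rewrite -expr2 sqr_ge0.
apply/ffunP => i; have := xx i (mem_index_enum i).
by rewrite ffunE mulf_eq0 orbb => /eqP.
Qed.

Lemma enorm_sqr x : enorm x ^+ 2 = dot x x.
Proof. by rewrite sqr_sqrtr ?dot_ge0. Qed.

Lemma enorm_ge0 x : 0 <= enorm x. Proof. exact: sqrtr_ge0. Qed.

Lemma enorm_le x y : (enorm x <= enorm y) = (dot x x <= dot y y).
Proof. by rewrite ler_sqrt ?dot_ge0. Qed.

Lemma coord_le_enorm x i : `|x i| <= enorm x.
Proof.
rewrite -(ler_pXn2r (_ : 0 < 2)%N) ?nnegrE ?enorm_ge0// enorm_sqr.
rewrite real_normK ?num_real// /dot (bigD1 i)//= -expr2 lerDl.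
by apply: sumr_ge0 => j _; rewrite -expr2 sqr_ge0.
Qed.

Lemma enorm_le_coord x (c : K) :
  (forall i, `|x i| <= c) -> enorm x <= #|I|%:R * c.
Proof.
move=> xc; have [I0|I0] := posnP #|I|.
  rewrite I0 mul0r /enorm /dot big1 ?sqrtr0// => i _.
  by have := card0_eq I0 i.
have [i0 _] : exists i : I, i \in I by apply/card_gt0P.
have c0 : 0 <= c by apply: le_trans (xc i0).
rewrite -(ler_pXn2r (_ : 0 < 2)%N) ?nnegrE ?enorm_ge0 ?mulr_ge0//.
rewrite enorm_sqr (@le_trans _ _ (\sum_(i : I) c ^+ 2))//.
  apply: ler_sum => i _; rewrite -expr2 -[X in X <= _]real_normK ?num_real//.
  by rewrite lerXn2r ?nnegrE.
rewrite sumr_const -[_ *+ #|_|]mulr_natl exprMn ler_wpM2r ?sqr_ge0// expr2.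
by rewrite ler_peMl// ler1n.
Qed.

Lemma sqr_sum_norm_le (x : {ffun I -> K}) :
  (\sum_v `|x v|) ^+ 2 <= #|I|%:R * dot x x.
Proof.
rewrite expr2 mulr_sumr.
have -> : #|I|%:R * dot x x =
    \sum_v \sum_w 2^-1 * (`|x v| ^+ 2 + `|x w| ^+ 2).
  have -> : dot x x = \sum_v `|x v| ^+ 2.
    by apply: eq_bigr => v _; rewrite real_normK ?num_real// expr2.
  have row (v : I) : \sum_w 2^-1 * (`|x v| ^+ 2 + `|x w| ^+ 2) =
      2^-1 * (#|I|%:R * `|x v| ^+ 2 + \sum_w `|x w| ^+ 2).
    by rewrite -mulr_sumr big_split sumr_const -[_ *+ #|_|]mulr_natl.
  rewrite [RHS](eq_bigr _ (fun v _ => row v)) -mulr_sumr big_split -mulr_sumr.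
  rewrite sumr_const; set S := \sum_v _; rewrite -[S *+ _]mulr_natl /=; lra.
apply: ler_sum => v _; rewrite mulr_suml; apply: ler_sum => w _.
by have := sqr_ge0 (`|x w| - `|x v|); lra.
Qed.

Definition convex_in C :=
  forall x y (t : K), C x -> C y -> 0 <= t <= 1 -> C (x + t *: (y - x)).

(** Along the segment from [p] to [q] the squared distance to [z] has slope
    [- 2 * dot (z - p) (q - p)] at [p], which must not be negative. *)
Lemma is_proj_obtuse C z p q :
  convex_in C -> is_proj C z p -> C q -> dot (z - p) (q - p) <= 0.
Proof.
move=> cC [Cp pmin] Cq; rewrite leNgt; apply/negP.
set c := dot _ _ => c0; pose s := dot (q - p) (q - p).
have s0 : 0 <= s := dot_ge0 _.
have cs0 : 0 < c + s by rewrite ltr_wpDr.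
(* Moving the fraction t towards q changes the squared distance by
   [t * (t * s - 2 * c)], and t is chosen with [t * s < c]. *)
pose t := c / (c + s).
have t0 : 0 < t by rewrite divr_gt0.
have t1 : t <= 1 by rewrite ler_pdivrMr// mul1r lerDl.
have := pmin _ (cC _ _ t Cp Cq _); rewrite (ltW t0) t1 => /(_ isT).
have expand (w v : {ffun I -> K}) : dot (w - t *: v) (w - t *: v) =
    dot w w - 2 * t * dot w v + t ^+ 2 * dot v v.
  by rewrite !dotE (dotC v w); ring.
rewrite enorm_le opprD addrA expand -/c -/s.
have : t * (c + s) = c by rewrite mulfVK// gt_eqF.
nra.
Qed.

Lemma obtuse_is_proj C z p :
  C p -> (forall q, C q -> dot (z - p) (q - p) <= 0) -> is_proj C z p.
Proof.
move=> Cp obt; split=> // q Cq; rewrite enorm_le.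
have := obt q Cq; have := dot_ge0 (q - p).
rewrite !dotE (dotC q p) (dotC q z) (dotC p z); lra.
Qed.

(** The sum of the two obtuse-angle inequalities at [p] and [p'] gives
    [dot (p - p') (p - p') <= dot (z - z') (p - p')]. *)
Lemma is_proj_dist_le C z z' p p' : convex_in C ->
  is_proj C z p -> is_proj C z' p' ->
  dot (p - p') (p - p') <= dot (z - z') (z - z').
Proof.
move=> cC zp zp'.
have := is_proj_obtuse cC zp zp'.1; have := is_proj_obtuse cC zp' zp.1.
have := dot_ge0 ((z - z') - (p - p')).
rewrite !dotE (dotC p' p) (dotC z' z) (dotC p z) (dotC p z') (dotC p' z).
rewrite (dotC p' z'); lra.
Qed.

(** The directions in which one can leave [p] inside a convex set form a convex
    cone: a point of the segment from [p + e *: u] to [p + f *: v] lies on the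
    ray of [u + v]. *)
Lemma feasible_directionD C p u v : convex_in C ->
  (exists2 e : K, 0 < e & C (p + e *: u)) ->
  (exists2 e : K, 0 < e & C (p + e *: v)) ->
  exists2 e : K, 0 < e & C (p + e *: (u + v)).
Proof.
move=> cC [e e0 Ce] [f f0 Cf].
have ef : 0 < e + f by rewrite addr_gt0.
exists (e * f / (e + f)); first by rewrite divr_gt0// mulr_gt0.
have := cC _ _ (e / (e + f)) Ce Cf.
rewrite (divr_ge0 (ltW e0) (ltW ef)) ler_pdivrMr// mul1r lerDl (ltW f0) => /(_ isT).
congr C; apply/ffunP => i; rewrite !ffunE /GRing.scale /=.
by field; rewrite gt_eqF.
Qed.

End Euclid.

(** * Existence of minimizers *)

Section Compactness.
Import ArrowAsProduct.
Context {K : realType} {I : finType}.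
Local Notation KI := (prod_topology (fun _ : I => K)).

Lemma continuous_coord (i : I) : continuous (fun u : KI => u i : K).
Proof. exact: proj_continuous. Qed.

Lemma continuous_sum (T : topologicalType) (J : Type) (s : seq J) (P : pred J)
    (f : J -> T -> K) :
  (forall j, P j -> continuous (f j)) ->
  continuous (fun u => \sum_(j <- s | P j) f j u).
Proof.
move=> fc u; apply: (cvg_big (op := +%R)) => [|j Pj]; last exact: fc.
exact: add_continuous.
Qed.

(** Closedness and continuity are read on the product space of all functions
    [I -> K], where boxes are compact by Tychonoff. *)
Lemma ex_minimizer (C : set {ffun I -> K}) (M : K) (g : {ffun I -> K} -> K) :
  C !=set0 -> (forall x, C x -> forall i, `|x i| <= M) ->
  closed [set u : KI | C (finfun u)] ->
  continuous (fun u : KI => g (finfun u)) ->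
  exists2 p, C p & forall q, C q -> g p <= g q.
Proof.
move=> [c Cc] CM Ccl gc.
have fK (x : {ffun I -> K}) : finfun (x : KI) = x.
  by apply/ffunP => i; rewrite ffunE.
have Ck : compact [set u : KI | C (finfun u)].
  have box := @tychonoff I (fun=> K) (fun=> `[- M, M]%classic)
    (fun=> @segment_compact _ (- M) M).
  apply: (subclosed_compact Ccl box) => u Cu i /=; rewrite in_itv /= -ler_norml.
  by have := CM _ Cu i; rewrite ffunE.
have [||p pC pmin] := @compact_EVT_min KI K (fun u => g (finfun u)) _ _ Ck.
- by exists (c : KI); rewrite /= fK.
- exact: continuous_subspaceT.
exists (finfun p) => [|q Cq]; first by rewrite inE in pC.
by rewrite -{1}(fK q); apply: pmin; rewrite inE /= fK.
Qed.

End Compactness.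

(** * Base polytopes and exchanges *)

Section BasePolytope.
Context {K : realType} {V : finType}.
Implicit Types (F : {set V} -> K) (s h : {ffun V -> K}) (A B W T : {set V}).

Lemma modularD s h A : modular (s + h) A = modular s A + modular h A.
Proof. by rewrite -big_split; apply: eq_bigr => v _; rewrite ffunE. Qed.

Lemma modularZ (t : K) s A : modular (t *: s) A = t * modular s A.
Proof. by rewrite mulr_sumr; apply: eq_bigr => v _; rewrite ffunE. Qed.

Lemma modularB s h A : modular (s - h) A = modular s A - modular h A.
Proof. by rewrite modularD -[- h]scaleN1r modularZ mulN1r. Qed.

Lemma modularUI s A B :
  modular s (A :|: B) + modular s (A :&: B) = modular s A + modular s B.
Proof.
rewrite /modular !(big_mkcond (fun v => v \in _)) -!big_split /=.
apply: eq_bigr => v _; rewrite !inE.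
by case: (v \in A); case: (v \in B); rewrite ?addr0 ?add0r.
Qed.

Lemma modular_sum (J : finType) (s : J -> {ffun V -> K}) A :
  modular (\sum_j s j) A = \sum_j modular (s j) A.
Proof.
rewrite /modular exchange_big; apply: eq_bigr => v _.
by rewrite sum_ffunE.
Qed.

Lemma base_polytope_convex F : convex_in (base_polytope F).
Proof.
move=> x y t [xF xV] [yF yV] /andP[t0 t1]; split=> [A|].
  rewrite modularD modularZ modularB.
  have := xF A; have := yF A; nra.
by rewrite modularD modularZ modularB xV yV subrr mulr0 addr0.
Qed.

Definition base_bound F : K := 2 * \sum_A `|F A|.

(** [s v] is at most [F] of the singleton [v], and at least [F] of the whole set
    minus [F] of the complement of [v]; the factor 2 in the bound covers the two
    terms of the latter crudely. *)
Lemma base_polytope_bounded F s v :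
  base_polytope F s -> `|s v| <= base_bound F.
Proof.
move=> [sF sV].
have FA A : `|F A| <= \sum_B `|F B|.
  by rewrite (bigD1 A)//= lerDl sumr_ge0.
have s1 : modular s [set v]%SET = s v by rewrite /modular big_set1.
have sC : modular s (~: [set v])%SET = F [set: V]%SET - s v.
  rewrite -sV -s1 -(finset.setUCr [set v]%SET).
  have := modularUI s [set v]%SET (~: [set v])%SET.
  by rewrite finset.setICr {2}/modular big_set0 addr0 => ->; rewrite addrC addKr.
have := sF [set v]%SET; have := sF (~: [set v])%SET; rewrite s1 sC.
have := FA [set v]%SET; have := FA (~: [set v])%SET; have := FA [set: V]%SET.
rewrite /base_bound !ler_norml => /andP[? ?] /andP[? ?] /andP[? ?].
by move=> *; apply/andP; split; lra.
Qed.

Definition chi v : {ffun V -> K} := [ffun w => (w == v)%:R].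

Lemma modular_chi v A : modular (chi v) A = (v \in A)%:R.
Proof.
rewrite /modular; have [vA|vA] := boolP (v \in A).
  rewrite (bigD1 v)//= ffunE eqxx big1 ?addr0// => w /andP[_ /negPf wv].
  by rewrite ffunE wv.
by rewrite big1// => w wA; rewrite ffunE; case: eqP wA vA => // -> ->.
Qed.

(** The values on [W] and on its complement are opposite, and their difference is
    at most the sum of the absolute values.  The factor 1/2 is needed for the
    error bound to give the rate with the decrease of one projection. *)
Lemma modular_le_half (t : {ffun V -> K}) (W : {set V}) :
  modular t [set: V]%SET = 0 -> modular t W <= 2^-1 * \sum_v `|t v|.
Proof.
move=> t0.
have : modular t W + modular t (~: W) = 0.
  rewrite -modularUI finset.setUCr finset.setICr t0 /modular big_set0.
  by rewrite addr0.
have : modular t W - modular t (~: W) <= \sum_v `|t v|.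
  rewrite /modular !(big_mkcond (fun v => v \in _)) -sumrB.
  apply: ler_sum => v _; rewrite inE.
  by have := ler_norm (t v); have := ler_norm (- t v); rewrite normrN;
    case: (v \in W) => /=; lra.
lra.
Qed.

Section Exchange.
Variables (F : {set V} -> K) (h : {ffun V -> K}).
Hypotheses (Fsub : submodular F) (hF : base_polytope F h).

Definition tight T := modular h T == F T.

Lemma tight_setT : tight [set: V]%SET. Proof. by apply/eqP; case: hF. Qed.

(** In [F A + F B >= F (A :|: B) + F (A :&: B) >= h (A :|: B) + h (A :&: B)] both
    ends coincide when [A] and [B] are tight. *)
Lemma tightUI A B : tight A -> tight B -> tight (A :|: B) /\ tight (A :&: B).
Proof.
move=> /eqP tA /eqP tB; have [hle _] := hF.
have := modularUI h A B; have := Fsub A B.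
have := hle (A :|: B); have := hle (A :&: B); rewrite /tight tA tB => *.
by split; apply/eqP; lra.
Qed.

(** The dependence function of polymatroid theory: the least tight set
    containing [v]. *)
Definition dep v : {set V} := \bigcap_(T | tight T && (v \in T)) T.

Lemma dep_tight v : tight (dep v).
Proof.
apply: (big_ind tight) => [|A B tA tB|A /andP[]//]; first exact: tight_setT.
by have [] := tightUI tA tB.
Qed.

Lemma dep_mem v : v \in dep v.
Proof. by apply/bigcapP => T /andP[]. Qed.

Lemma dep_min u v T : u \in dep v -> tight T -> v \in T -> u \in T.
Proof. by move=> /bigcapP uv tT vT; apply: uv; rewrite tT. Qed.

(** Raising [h v] and lowering [h u] can only violate constraints on sets that
    contain [v] but not [u]; none of them is tight, and they are finitely many. *)
Lemma exchange_feasible u v : u \in dep v ->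
  exists2 e : K, 0 < e & base_polytope F (h + e *: (chi v - chi u)).
Proof.
move=> uv; have [hle hV] := hF.
pose e : K := \big[Num.min/1]_(T | ~~ tight T) (F T - modular h T).
have e0 : 0 < e.
  apply: (big_ind (fun x : K => 0 < x)) => // [x y x0 y0|T tT].
    by rewrite lt_min x0.
  by rewrite subr_gt0 lt_neqAle hle andbT.
exists e => //; split=> [T|].
  rewrite modularD modularZ modularB !modular_chi.
  have [tT|ntT] := boolP (tight T).
    have := hle T; have := dep_min uv tT.
    case: (v \in T) => [->//|_]; first by rewrite subrr mulr0 addr0.
    by case: (u \in T) => /=; lra.
  have : e <= F T - modular h T by apply: bigmin_le_cond.
  by have := hle T; case: (v \in T); case: (u \in T) => /=; lra.
by rewrite modularD modularZ modularB !modular_chi !finset.in_setT subrr mulr0 addr0.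
Qed.

(** The union [D] of the sets [dep v], over the [v] of [W] where [h v < b v], is
    tight, so [b D <= F D = h D].  Replacing [D] by [W] only increases the total
    of [h - b]: it adds no negative term (each of those in [W] is in [D]) and it
    loses no positive one (by the hypothesis on [W]). *)
Lemma closed_set_ge0 b W : F finset.set0 = 0 -> base_polytope F b ->
  (forall v, v \in W -> h v < b v ->
    forall u, u \in dep v -> b u < h u -> u \in W) ->
  modular b W <= modular h W.
Proof.
move=> F0 [bF _] Wcl.
pose D := \bigcup_(v in W | h v < b v) dep v.
have tD : tight D.
  apply: (big_ind tight) => [|A B tA tB|v _]; last exact: dep_tight.
    by rewrite /tight /modular big_set0 F0.
  by have [] := tightUI tA tB.
have : modular b D <= modular h D by rewrite (eqP tD).
rewrite -[modular b W <= _]subr_ge0 -subr_ge0 -!modularB.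
move=> /le_trans; apply; rewrite /modular !(big_mkcond (fun v => v \in _)).
apply: ler_sum => w _; rewrite !ffunE.
have [hb|bh|<-] := ltgtP (h w) (b w).
- have [wW|] := boolP (w \in W).
    suff -> : w \in D by [].
    by apply/bigcupP; exists w; rewrite ?wW ?hb ?dep_mem.
  by move=> _; case: ifP => // _; lra.
- have [/bigcupP[v /andP[vW hbv] wv]|_] := boolP (w \in D).
    by rewrite (Wcl v).
  by case: ifP => // _; lra.
- by rewrite subrr; do 2!case: ifP.
Qed.

End Exchange.
End BasePolytope.

(** * Block sums and the projection onto the sum-zero space *)

Section BlockSum.
Context {K : realType} {V : finType} {R : nat}.
Implicit Types (w z : {ffun 'I_R * V -> K}) (s t : {ffun V -> K}).

Definition block_sum w : {ffun V -> K} := \sum_(r < R) block w r.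

Lemma block_sumE w v : block_sum w v = \sum_(r < R) w (r, v).
Proof. by rewrite sum_ffunE; apply: eq_bigr => r _; rewrite ffunE. Qed.

Lemma blockD w z r : block (w + z) r = block w r + block z r.
Proof. by apply/ffunP => v; rewrite !ffunE. Qed.

Lemma blockZ (t : K) w r : block (t *: w) r = t *: block w r.
Proof. by apply/ffunP => v; rewrite !ffunE. Qed.

Lemma block_sumD w z : block_sum (w + z) = block_sum w + block_sum z.
Proof. by rewrite -big_split; apply: eq_bigr => r _; rewrite blockD. Qed.

Lemma block_sumZ (t : K) w : block_sum (t *: w) = t *: block_sum w.
Proof. by rewrite scaler_sumr; apply: eq_bigr => r _; rewrite blockZ. Qed.

Lemma block_sumB w z : block_sum (w - z) = block_sum w - block_sum z.
Proof. by rewrite block_sumD -scaleN1r block_sumZ scaleN1r. Qed.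

Lemma dot_blocks w z : dot w z = \sum_(r < R) dot (block w r) (block z r).
Proof.
rewrite /dot pair_bigA /=; apply: eq_bigr => -[r v] _.
by rewrite !ffunE.
Qed.

Definition block_chi (r : 'I_R) (v : V) : {ffun 'I_R * V -> K} :=
  [ffun p => (p == (r, v))%:R].

Lemma dot_block_chi r v w : dot w (block_chi r v) = w (r, v).
Proof.
rewrite /dot (bigD1 (r, v))//= ffunE eqxx mulr1 big1 ?addr0// => p /negPf pv.
by rewrite ffunE pv mulr0.
Qed.

Lemma block_block_chi r v r' :
  block (block_chi r v) r' = (r' == r)%:R *: chi v.
Proof.
apply/ffunP => w; rewrite !ffunE xpair_eqE /GRing.scale /= -natrM mulnb.
by [].
Qed.

Lemma block_sum_block_chi r v : block_sum (block_chi r v) = chi v.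
Proof.
rewrite /block_sum (bigD1 r)//= block_block_chi eqxx scale1r big1 ?addr0//.
by move=> r' /negPf r'r; rewrite block_block_chi r'r scale0r.
Qed.

(** The vectors [spread s] form the orthogonal complement of the sum-zero space,
    and [spread (block_sum w)] is the component of [w] in it. *)
Definition spread s : {ffun 'I_R * V -> K} := [ffun p => s p.2 / R%:R].

Lemma spreadB s t : spread (s - t) = spread s - spread t.
Proof. by apply/ffunP => p; rewrite !ffunE mulrBl. Qed.

Lemma dot_spread s w : dot (spread s) w = dot s (block_sum w) / R%:R.
Proof.
rewrite dot_blocks /dot exchange_big /= mulr_suml.
apply: eq_bigr => v _; rewrite block_sumE mulr_sumr mulr_suml.
by apply: eq_bigr => r _; rewrite !ffunE mulrAC.
Qed.

Lemma dot_spread_add s w : block_sum w = 0 ->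
  dot (spread s + w) (spread s + w) = dot (spread s) (spread s) + dot w w.
Proof.
move=> w0; rewrite dotDl !dotDr (dotC w (spread s)) (dot_spread s w) w0.
rewrite [dot _ 0]big1 => [|i _]; last by rewrite ffunE mulr0.
by rewrite mul0r addr0 add0r.
Qed.

Hypothesis R0 : (0 < R)%N.

Let Rneq0 : R%:R != 0 :> K. Proof. by rewrite pnatr_eq0 -lt0n. Qed.

Lemma block_sum_spread s : block_sum (spread s) = s.
Proof.
apply/ffunP => v; rewrite block_sumE (eq_bigr (fun=> s v / R%:R)); last first.
  by move=> r _; rewrite ffunE.
by rewrite sumr_const card_ord -[_ *+ _]mulr_natr mulfVK.
Qed.

Lemma dot_sub_spread w :
  dot (w - spread (block_sum w)) (w - spread (block_sum w)) =
  dot w w - dot (block_sum w) (block_sum w) / R%:R.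
Proof.
rewrite !dotE (dotC w) !dot_spread block_sum_spread.
by ring.
Qed.

Lemma dot_block_sum_le w :
  dot (block_sum w) (block_sum w) / R%:R <= dot w w.
Proof. by rewrite -subr_ge0 -dot_sub_spread dot_ge0. Qed.

Lemma is_proj_sum_zero w p :
  is_proj sum_zero_space w p -> p = w - spread (block_sum w).
Proof.
move=> [p0 pmin]; set q := w - _.
have q0 : sum_zero_space q.
  by rewrite /sum_zero_space /= -/(block_sum q) block_sumB block_sum_spread subrr.
have := pmin _ q0; rewrite enorm_le.
have -> : w - p = spread (block_sum w) + (q - p) by rewrite /q addrA [_ + (w - _)]addrC subrK.
have -> : w - q = spread (block_sum w) by rewrite /q opprB addrC subrK.
have qp0 : block_sum (q - p) = 0 by rewrite block_sumB [block_sum q]q0 [block_sum p]p0 subrr.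
rewrite dot_spread_add// gerDl => /dot_le0_eq0 /eqP.
by rewrite subr_eq0 => /eqP.
Qed.

End BlockSum.

(** * Fibers of the block sum over the product polytope *)

Section ProductPolytope.
Context {K : realType} {V : finType} {R : nat}.
Variable F : 'I_R -> {set V} -> K.
Local Notation B := (prod_base F).

Lemma prod_base_convex : convex_in B.
Proof.
move=> x y t Bx By t01 r.
have := base_polytope_convex (Bx r) (By r) t01.
congr (base_polytope _ _); apply/ffunP => v; by rewrite !ffunE.
Qed.

Definition fiber (s : {ffun V -> K}) : set {ffun 'I_R * V -> K} :=
  [set w | B w /\ block_sum w = s].

Lemma fiber_convex s : convex_in (fiber s).
Proof.
move=> x y t [Bx xs] [By ys] t01; split; first exact: prod_base_convex.
by rewrite block_sumD block_sumZ block_sumB xs ys subrr scaler0 addr0.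
Qed.

Lemma prod_base_bounded w p : B w -> `|w p| <= \sum_r base_bound (F r).
Proof.
move=> Bw; have := base_polytope_bounded p.2 (Bw p.1).
rewrite ffunE -surjective_pairing => /le_trans; apply.
rewrite (bigD1 p.1)//= lerDl sumr_ge0// => r _.
by rewrite mulr_ge0// sumr_ge0.
Qed.

Local Notation KI := (prod_topology (fun _ : 'I_R * V => K)).

Lemma modular_block_continuous r A :
  continuous (fun u : KI => modular (block (finfun u) r) A).
Proof.
rewrite /modular (_ : (fun u => _) = fun u : KI => \sum_(v in A) u (r, v)).
  by apply: continuous_sum => v _; exact: continuous_coord.
by apply/funext => u; apply: eq_bigr => v _; rewrite !ffunE.
Qed.

Lemma block_sum_continuous v :
  continuous (fun u : KI => block_sum (finfun u) v).
Proof.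
rewrite (_ : (fun u => _) = fun u : KI => \sum_r u (r, v)).
  by apply: continuous_sum => r _; exact: continuous_coord.
by apply/funext => u; rewrite block_sumE; apply: eq_bigr => r _; rewrite ffunE.
Qed.

Lemma prod_base_closed : closed [set u : KI | B (finfun u)].
Proof.
rewrite (_ : [set _ | _] = \bigcap_(r in [set: 'I_R]) (
  (\bigcap_(A in [set: {set V}])
     ((fun u : KI => modular (block (finfun u) r) A) @^-1` [set x | x <= F r A]))
  `&` ((fun u : KI => modular (block (finfun u) r) [set: V]%SET) @^-1`
     [set F r [set: V]%SET]))); last first.
  apply/seteqP; split => u /= Bu r => [_|]; last first.
    by have [h1 h2] := Bu r I; split=> // A; exact: h1.
  by have [h1 h2] := Bu r; split=> // A _; exact: h1.
apply: closed_bigI => r _; apply: closedI.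
  apply: closed_bigI => A _; apply: preimage_closed; last exact: closed_le.
  by move=> u _; exact: modular_block_continuous.
apply: preimage_closed; last exact: closed_eq.
by move=> u _; exact: modular_block_continuous.
Qed.

Lemma fiber_closed s : closed [set u : KI | fiber s (finfun u)].
Proof.
rewrite (_ : [set _ | _] = [set u : KI | B (finfun u)] `&`
  \bigcap_(v in [set: V]) ((fun u : KI => block_sum (finfun u) v) @^-1`
     [set s v])); last first.
  apply/seteqP; split => u /= [Bu us]; split=> //.
    by move=> v _; rewrite /= us.
  by apply/ffunP => v; exact: us.
apply: closedI; first exact: prod_base_closed.
apply: closed_bigI => v _; apply: preimage_closed; last exact: closed_eq.
by move=> u _; exact: block_sum_continuous.
Qed.

(** The inequality is the optimality condition for the point of least norm in the
    image of the product polytope under the block sum. *)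
Lemma ex_min_block_sum : B !=set0 ->
  exists2 b, B b & forall w, B w ->
    0 <= dot (block_sum b) (block_sum w - block_sum b).
Proof.
move=> B0.
have [||b Bb bmin] := @ex_minimizer _ _ B (\sum_r base_bound (F r))
  (fun w => dot (block_sum w) (block_sum w)) B0 _ prod_base_closed.
- by move=> w Bw p; exact: prod_base_bounded.
- apply: (@continuous_sum _ KI _ _ _ (fun v u =>
    block_sum (finfun u) v * block_sum (finfun u) v)) => v _ u.
  exact: (cvgM (@block_sum_continuous v u) (@block_sum_continuous v u)).
exists b => // w Bw.
pose C := block_sum @` B.
have Cc : convex_in C.
  move=> _ _ t [x Bx <-] [y By <-] t01.
  exists (x + t *: (y - x)); first exact: prod_base_convex.
  by rewrite block_sumD block_sumZ block_sumB.
have bp : is_proj C 0 (block_sum b).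
  split=> [|_ [x Bx <-]]; first by exists b.
  by rewrite !sub0r enorm_le !dotNl !dotNr !opprK bmin.
have := is_proj_obtuse Cc bp (imageP _ Bw).
by rewrite sub0r dotNl oppr_le0.
Qed.

Lemma ex_proj_fiber s b : fiber s !=set0 -> exists h, is_proj (fiber s) b h.
Proof.
move=> s0.
have [||h Hh hmin] := @ex_minimizer _ _ (fiber s) (\sum_r base_bound (F r))
  (fun w => dot (b - w) (b - w)) s0 _ (@fiber_closed s).
- by move=> w [Bw _] p; exact: prod_base_bounded.
- rewrite (_ : (fun u => _) =
    (fun u : KI => \sum_p (b p - u p) * (b p - u p))); last first.
    by apply/funext => u; apply: eq_bigr => p _; rewrite !ffunE.
  apply: (@continuous_sum _ KI _ _ _ (fun p u =>
    (b p - u p) * (b p - u p))) => p _ u.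
  have bu : continuous (fun u' : KI => b p - u' p).
    move=> u'.
    exact: (cvgB (cvg_cst (b p)) (@continuous_coord _ _ p u')).
  exact: (cvgM (bu u) (bu u)).
by exists h; split=> // q Hq; rewrite enorm_le hmin.
Qed.

End ProductPolytope.

(** * The error bound *)

Section ErrorBound.
Context {K : realType} {V : finType} {R : nat}.
Variable F : 'I_R -> {set V} -> K.
Hypotheses (Fsub : forall r, submodular (F r)).
Hypothesis (F0 : forall r, F r finset.set0 = 0).
Variables (s : {ffun V -> K}) (b h : {ffun 'I_R * V -> K}).
Hypotheses (Bb : prod_base F b) (hproj : is_proj (fiber F s) b h).

Let d := h - b.
Let Bh : prod_base F h. Proof. by case: hproj => -[]. Qed.

(** An edge from [v] to [u] is an exchange that, inside some block, moves [h]
    towards [b] in both coordinates [v] and [u]. *)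
Definition exchange_edge (v u : V) : bool := [exists r : 'I_R,
  [&& h (r, v) < b (r, v), b (r, u) < h (r, u)
    & u \in dep (F r) (block h r) v]].

Lemma edge_direction v u : exchange_edge v u ->
  exists z : {ffun 'I_R * V -> K},
    [/\ exists2 e : K, 0 < e & prod_base F (h + e *: z),
        block_sum z = chi v - chi u & dot d z < 0].
Proof.
move=> /existsP[r /and3P[hv hu uv]].
exists (block_chi r v - block_chi r u); split.
- have [e e0 he] := exchange_feasible (Bh r) uv.
  exists e => // r'; rewrite blockD blockZ blockD -[- block_chi r u]scaleN1r.
  rewrite blockZ !block_block_chi; have [->|r'r] := eqVneq r' r.
    by rewrite !scale1r scaleN1r.
  by rewrite !scale0r scaler0 addr0 scaler0 addr0.
- by rewrite block_sumB !block_sum_block_chi.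
- by rewrite dotDr dotNr !dot_block_chi !ffunE; lra.
Qed.

(** The exchanges along a path add up, and their effects on the block sum
    telescope. *)
Lemma path_direction v u : connect exchange_edge v u ->
  exists z : {ffun 'I_R * V -> K},
    [/\ exists2 e : K, 0 < e & prod_base F (h + e *: z),
        block_sum z = chi v - chi u & dot d z <= 0].
Proof.
move=> /connectP[p]; elim: p v => [|w p IHp] v /= => [_ ->|].
  exists (0 *: h); split.
  - by exists 1 => //; rewrite scale0r scaler0 addr0.
  - by rewrite subrr block_sumZ scale0r.
  - by rewrite dotZr mul0r.
move=> /andP[vw wp] up; have [z [zB zs zd]] := IHp _ wp up.
have [y [yB ys yd]] := edge_direction vw.
exists (y + z); split.
- exact: (feasible_directionD (@prod_base_convex _ _ _ F) yB zB).
- by rewrite block_sumD ys zs addrA subrK.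
- by rewrite dotDr; lra.
Qed.

(** The exchanges along a cycle leave the block sum unchanged, so they lead from
    [h] to points of the same fiber; as they move [h] towards [b], this would
    contradict that [h] is the point of the fiber nearest to [b]. *)
Lemma exchange_acyclic v u : exchange_edge v u -> ~~ connect exchange_edge u v.
Proof.
move=> vu; apply/negP => uv.
have [z [zB zs zd]] := path_direction uv.
have [y [yB ys yd]] := edge_direction vu.
have [e e0 he] := feasible_directionD (@prod_base_convex _ _ _ F) yB zB.
have Hh : fiber F s (h + e *: (y + z)).
  split=> //; rewrite block_sumD block_sumZ block_sumD ys zs.
  by rewrite addrA subrK subrr scaler0 addr0; case: hproj => -[].
have := is_proj_obtuse (@fiber_convex _ _ _ F s) hproj Hh.
rewrite [h + _]addrC addrK -opprB -/d dotNl dotZr dotDr oppr_le0 leNgt.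
by rewrite pmulr_rlt0//; case/negP; lra.
Qed.

Lemma edge_closed_ge0 r (W : {set V}) :
  (forall v u, v \in W -> exchange_edge v u -> u \in W) ->
  0 <= modular (block d r) W.
Proof.
move=> Wcl.
have -> : block d r = block h r - block b r.
  by apply/ffunP => v; rewrite !ffunE.
rewrite modularB subr_ge0.
apply: (closed_set_ge0 (Fsub r) (Bh r) (F0 r) (Bb r)) => v vW.
rewrite !ffunE => hv u uv; rewrite !ffunE => hu.
by apply: (Wcl v) => //; apply/existsP; exists r; rewrite hv hu uv.
Qed.

Let t := s - block_sum b.

Lemma block_sum_d : block_sum d = t.
Proof. by rewrite block_sumB; case: hproj => -[_ ->]. Qed.

Lemma modular_block_sum W :
  \sum_r modular (block d r) W = modular t W.
Proof. by rewrite -block_sum_d -modular_sum. Qed.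

Lemma modular_t_setT : modular t [set: V]%SET = 0.
Proof.
rewrite -modular_block_sum big1// => r _.
have -> : block d r = block h r - block b r.
  by apply/ffunP => v; rewrite !ffunE.
by rewrite modularB (Bh r).2 (Bb r).2 subrr.
Qed.

Lemma modular_block_le r (W : {set V}) :
  (forall v u, v \in W -> exchange_edge v u -> u \in W) ->
  modular (block d r) W <= 2^-1 * \sum_v `|t v|.
Proof.
move=> Wcl; apply: le_trans (modular_le_half W modular_t_setT).
rewrite -modular_block_sum (bigD1 r)//= lerDl sumr_ge0// => r' _.
exact: edge_closed_ge0.
Qed.

(** Sets closed under edges have nonnegative total of [d] in every block, and the
    totals over the blocks add up to that of [t].  So if a block has total at
    least [`|d p|] on a closed set, then [`|d p|] is at most the total of [t] on
    that set.  Acyclicity is what makes the closed sets below work: [u] can be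
    added to or removed from them without losing closedness. *)
Lemma displacement_le (p : 'I_R * V) : `|d p| <= 2^-1 * \sum_v `|t v|.
Proof.
case: p => r u; rewrite ler_norml; apply/andP; split.
  (* If [d (r, u) < 0], the closed set consists of the points that do not lead to
     [u]: adding [u] to it gives a closed set whose total in block r is still
     nonnegative. *)
  pose W := [set v | ~~ connect exchange_edge v u]%SET.
  have Wcl v w : v \in W -> exchange_edge v w -> w \in W.
    rewrite !inE => vu vw; apply: contra vu => wu.
    exact: connect_trans (connect1 vw) wu.
  have uW : u \notin W by rewrite inE negbK connect0.
  have uWcl v w : v \in (u |: W)%SET -> exchange_edge v w -> w \in (u |: W)%SET.
    rewrite in_setU1 => /predU1P[-> uw|vW vw].
      by rewrite in_setU1 inE exchange_acyclic ?orbT.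
    by rewrite in_setU1 (Wcl _ _ vW vw) orbT.
  have := modular_block_le r Wcl; have := edge_closed_ge0 r uWcl.
  rewrite {1}/modular big_setU1//= [block d r u]ffunE -/(modular _ _); lra.
(* If [d (r, u) > 0], the closed set consists of the points reached from [u]:
   without [u] it is still closed, as no cycle leads back to [u]. *)
have [hu|] := ltP 0 (d (r, u)); last first.
  by move=> /le_trans; apply; rewrite mulr_ge0// sumr_ge0.
pose W := [set v | connect exchange_edge u v]%SET.
have uW : u \in W by rewrite inE connect0.
have Wcl v w : v \in W -> exchange_edge v w -> w \in W.
  by rewrite !inE => uv vw; exact: connect_trans uv (connect1 vw).
have W'cl v w : v \in (W :\ u)%SET -> exchange_edge v w -> w \in (W :\ u)%SET.
  rewrite !in_setD1 => /andP[_ vW] vw.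
  rewrite (Wcl v)// andbT; apply/eqP => wu; move: vw; rewrite wu.
  by move=> /exchange_acyclic; move: vW; rewrite inE => ->.
have := modular_block_le r Wcl; have := edge_closed_ge0 r W'cl.
rewrite {2}/modular (big_setD1 u uW)/= [block d r u]ffunE -/(modular _ _); lra.
Qed.

(** Each of the [R * #|V|] coordinates of [h - b] is at most half the 1-norm of
    [t], and the 1-norm is compared with the Euclidean one by Cauchy-Schwarz. *)
Lemma fiber_error_bound :
  dot (h - b) (h - b) <=
  (#|V|%:R ^+ 2 * R%:R) / 4 * dot (s - block_sum b) (s - block_sum b).
Proof.
rewrite -/d -/t.
apply: (@le_trans _ _ (\sum_(p : 'I_R * V) (4^-1 * (#|V|%:R * dot t t)))).
  apply: ler_sum => p _.
  rewrite -expr2 -[X in X <= _]real_normK ?num_real//.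
  have := displacement_le p; have := sqr_sum_norm_le t.
  set S := \sum_v _ => S2 pS.
  have : `|d p| ^+ 2 <= (2^-1 * S) ^+ 2 by rewrite lerXn2r ?nnegrE ?(le_trans _ pS).
  by rewrite exprMn; lra.
rewrite sumr_const card_prod card_ord -[_ *+ _]mulr_natl natrM; lra.
Qed.

End ErrorBound.

(** * One iteration of alternating projections *)

Section AlternatingStep.
Context {K : realType} {V : finType} {R : nat}.
Hypothesis R0 : (0 < R)%N.
Variable F : 'I_R -> {set V} -> K.
Variable s : {ffun V -> K}.
Hypothesis s_min :
  forall w, prod_base F w -> 0 <= dot s (block_sum w - s).
Variables b b' : {ffun 'I_R * V -> K}.
Hypotheses (Bb : prod_base F b)
  (b'P : is_proj (prod_base F) (b - spread (block_sum b)) b').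

Let gap := dot (s - block_sum b) (s - block_sum b).

(** The point [h - spread s] of the sum-zero space and [h] are projections of each
    other, so the step to [b'] brings [b] closer to [h]: the projection onto the
    sum-zero space removes from [b - h] exactly its [spread] component, and the
    projection onto the product polytope is nonexpansive. *)
Lemma alternating_step_fejer h : fiber F s h ->
  dot (b' - h) (b' - h) <= dot (b - h) (b - h) - gap / R%:R.
Proof.
move=> [Bh hs].
have hP : is_proj (prod_base F) (h - spread s) h.
  apply: obtuse_is_proj => // q Bq.
  rewrite addrAC subrr sub0r dotNl oppr_le0 dot_spread block_sumB hs.
  by rewrite divr_ge0 ?s_min.
apply: le_trans (is_proj_dist_le (@prod_base_convex _ _ _ F) b'P hP) _.
have -> : b - spread (block_sum b) - (h - spread s) =
    (b - h) - spread (block_sum (b - h)).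
  by rewrite block_sumB hs spreadB; apply/ffunP => p; rewrite !ffunE; ring.
rewrite (dot_sub_spread R0) block_sumB hs /gap.
by rewrite -(opprB (block_sum b)) dotNl dotNr opprK.
Qed.

Hypotheses (Fsub : forall r, submodular (F r))
  (F0 : forall r, F r finset.set0 = 0) (V0 : (0 < #|V|)%N).

(** With [q := 1 / (#|V| ^ 2 * R ^ 2)], the error bound makes the decrease at least
    [4 * q] times the squared distance, and [1 - 4 * q <= (1 - q) ^+ 2]. *)
Lemma alternating_step_contraction h h' :
  is_proj (fiber F s) b h -> is_proj (fiber F s) b' h' ->
  dot (b' - h') (b' - h') <=
  (1 - 1 / (#|V|%:R ^+ 2 * R%:R ^+ 2)) ^+ 2 * dot (b - h) (b - h).
Proof.
move=> hP h'P; have Hh := hP.1.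
have := h'P.2 _ Hh; rewrite enorm_le => /le_trans; apply.
apply: le_trans (alternating_step_fejer Hh) _.
have := fiber_error_bound Fsub F0 Bb hP; rewrite -/gap.
rewrite -(opprB b) dotNl dotNr opprK; set D := dot _ _.
have D0 : 0 <= D := dot_ge0 _.
have r0 : 0 < R%:R :> K by rewrite ltr0n.
have n0 : 0 < #|V|%:R :> K by rewrite ltr0n.
set q : K := 1 / _ => Dgap.
have q0 : 0 < q by rewrite divr_gt0// mulr_gt0// exprn_gt0.
have : 4 * q * D <= gap / R%:R.
  have -> : gap / R%:R = 4 * q * (#|V|%:R ^+ 2 * R%:R / 4 * gap).
    by rewrite /q; field; rewrite !gt_eqF.
  by rewrite ler_pM2l// mulr_gt0.
have : 0 <= (2 * q + q ^+ 2) * D by rewrite mulr_ge0// addr_ge0 ?sqr_ge0// mulr_ge0// ltW.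
lra.
Qed.

End AlternatingStep.

(** * Sequences with geometric error *)

Section LinearRate.
Context {K : realType}.
Variable rho : K.
Hypotheses (rho0 : 0 <= rho) (rho1 : rho < 1).

Lemma cvg_geometric_bound (c : K) : c * rho ^+ k @[k --> \oo] --> (0 : K).
Proof. by have := @cvg_geometric K c rho; rewrite ger0_norm//; apply. Qed.

Lemma squeeze_geometric (u : nat -> K) (c : K) :
  (forall k, 0 <= u k <= c * rho ^+ k) -> u k @[k --> \oo] --> (0 : K).
Proof.
move=> uc; apply: (@squeeze_cvgr _ _ _ _ (fun=> 0) (fun k => c * rho ^+ k)).
- by near=> k; exact: uc.
- exact: cvg_cst.
- exact: cvg_geometric_bound.
Unshelve. all: by end_near.
Qed.

Lemma geometric_cauchy_limit (u : nat -> K) (c : K) :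
  (forall m k, (k <= m)%N -> `|u m - u k| <= c * rho ^+ k) ->
  exists l, forall k, `|u k - l| <= c * rho ^+ k.
Proof.
move=> uc.
have c0 : 0 <= c by have := uc 0 0 (leqnn _); rewrite subrr normr0 expr0 mulr1.
have cu : cvgn u.
  apply/cauchy_cvgP/cauchyP => e e0.
  have /cvgrPdist_lt/(_ _ e0)[k _ ke] := cvg_geometric_bound c.
  exists (u k); exists k => // m /= km.
  rewrite /ball /= distrC; apply: le_lt_trans (uc _ _ km) _.
  have := ke k (leqnn k); rewrite sub0r normrN ger0_norm//.
  by rewrite mulr_ge0// exprn_ge0.
exists (limn u) => k; rewrite distrC.
have cd : `|u m - u k| @[m --> \oo] --> `|limn u - u k|.
  by apply: cvg_norm; apply: cvgB => //; exact: cvg_cst.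
apply: (ler_cvg_to cd (cvg_cst _)).
by near=> m; apply: uc; near: m; exact: nbhs_infty_ge.
Unshelve. all: by end_near.
Qed.

End LinearRate.

(** * Lipschitz continuity of the objective *)

Section Objective.
Context {K : realType} {V : finType}.
Variables (G : {set V} -> K) (L : K).
Hypothesis GL : forall t, base_polytope G t -> forall v, `|t v| <= L.

(** A maximum of linear forms with coefficients bounded by [L] is [L]-Lipschitz for
    the 1-norm. *)
Lemma lovasz_le (x y : {ffun V -> K}) : base_polytope G !=set0 ->
  lovasz G x <= lovasz G y + L * \sum_v `|x v - y v|.
Proof.
move=> [t0 Gt0]; rewrite {1}/lovasz; apply: ge_sup.
  by exists (dot t0 x); exists t0.
move=> _ [t Gt <-].
have dot_le z : dot t z <= L * \sum_v `|z v|.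
  rewrite mulr_sumr; apply: ler_sum => v _; apply: le_trans (ler_norm _) _.
  by rewrite normrM ler_wpM2r// GL.
have ty : dot t y <= lovasz G y.
  apply: ub_le_sup; last by exists t.
  exists (L * \sum_v `|y v|) => _ [u Gu <-].
  rewrite mulr_sumr; apply: ler_sum => v _; apply: le_trans (ler_norm _) _.
  by rewrite normrM ler_wpM2r// GL.
rewrite -[x](subrK y) dotDr addrC lerD// subrK; apply: le_trans (dot_le _) _.
by rewrite le_eqVlt; apply/orP; left; apply/eqP; congr (_ * _);
  apply: eq_bigr => v _; rewrite !ffunE.
Qed.

Definition objective (x : {ffun V -> K}) : K :=
  lovasz G x + 2^-1 * enorm x ^+ 2.

(** The points [x] and [y] are opposite to points of the base polytope, so their
    coordinates are bounded by [L]; this makes the quadratic term Lipschitz. *)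
Lemma objective_lipschitz (x y : {ffun V -> K}) :
  base_polytope G (- x) -> base_polytope G (- y) ->
  `|objective x - objective y| <= 2 * L * \sum_v `|x v - y v|.
Proof.
move=> Gx Gy; rewrite /objective !enorm_sqr.
have xy := @lovasz_le x y (ex_intro _ _ Gx).
have := @lovasz_le y x (ex_intro _ _ Gx).
rewrite (eq_bigr (fun v => `|x v - y v|)) => [yx|v _]; last by rewrite distrC.
have : `|dot x x - dot y y| <= 2 * L * \sum_v `|x v - y v|.
  rewrite -sumrB mulr_sumr; apply: le_trans (ler_norm_sum _ _ _) _.
  apply: ler_sum => v _.
  have -> : x v * x v - y v * y v = (x v + y v) * (x v - y v) by ring.
  rewrite normrM ler_wpM2r//; apply: le_trans (ler_normD _ _) _.
  have := GL Gx v; have := GL Gy v; rewrite !ffunE !normrN; lra.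
by rewrite !ler_norml => /andP[? ?]; apply/andP; split; lra.
Qed.

End Objective.

(** * Convergence of the iterates *)

Lemma block_sum_base (K : realType) (V : finType) (R : nat)
    (F : 'I_R -> {set V} -> K) w : prod_base F w ->
  base_polytope (fun A => \sum_(r < R) F r A) (block_sum w).
Proof.
move=> Bw; split=> [A|]; rewrite modular_sum.
  by apply: ler_sum => r _; have [] := Bw r.
by apply: eq_bigr => r _; have [] := Bw r.
Qed.

Lemma cvg_real_sum (K : realType) (J : finType) (P : pred J)
    (u : J -> nat -> K) (l : J -> K) :
  (forall j, u j k @[k --> \oo] --> l j) ->
  \sum_(j | P j) u j k @[k --> \oo] --> \sum_(j | P j) l j.
Proof. by move=> ul; apply: (cvg_big (op := +%R)) => //; exact: add_continuous. Qed.

Lemma fiber_cvg (K : realType) (V : finType) (R : nat)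
    (F : 'I_R -> {set V} -> K) (s : {ffun V -> K})
    (h : nat -> {ffun 'I_R * V -> K}) (l : {ffun 'I_R * V -> K}) :
  (forall k, fiber F s (h k)) ->
  (forall p, h k p @[k --> \oo] --> l p) -> fiber F s l.
Proof.
move=> Hh hl.
have mod_cvg r A :
    modular (block (h k) r) A @[k --> \oo] --> modular (block l r) A.
  rewrite /modular; apply: cvg_real_sum => v.
  rewrite ffunE (_ : (fun k => _) = fun k => h k (r, v)); first exact: hl.
  by apply/funext => k; rewrite ffunE.
split=> [r|]; first split=> [A|].
- apply: (ler_cvg_to (mod_cvg r A) (cvg_cst (F r A))).
  by near=> k; exact: ((Hh k).1 r).1.
- have FV : modular (block (h k) r) [set: V]%SET @[k --> \oo] -->
      F r [set: V]%SET.
    rewrite (_ : (fun k => _) = fun=> F r [set: V]%SET); first exact: cvg_cst.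
    by apply/funext => k; rewrite ((Hh k).1 r).2.
  exact: (cvg_unique _ (mod_cvg r _) FV).
apply/ffunP => v; rewrite block_sumE.
have sv : \sum_(r < R) h k (r, v) @[k --> \oo] --> s v.
  rewrite (_ : (fun k => _) = fun=> s v); first exact: cvg_cst.
  by apply/funext => k; rewrite -(Hh k).2 block_sumE.
exact: (cvg_unique _ (@cvg_real_sum _ _ xpredT _ _ (fun r => hl (r, v))) sv).
Unshelve. all: by end_near.
Qed.

Theorem proposition15 (K : realType) (V : finType) (N R : nat)
    (hV : #|V| = N) (hN : (1 <= N)%N) (hR : (1 <= R)%N)
    (Fr : 'I_R -> {set V} -> K)
    (hsub : forall r, submodular (Fr r))
    (h0 : forall r, Fr r finset.set0 = 0)
    (a b : nat -> {ffun 'I_R * V -> K})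
    (ha0 : sum_zero_space (a 0%N))
    (hb : forall k, is_proj (prod_base Fr) (a k) (b k))
    (ha : forall k, is_proj sum_zero_space (b k) (a k.+1)) :
  let F : {set V} -> K := fun A => \sum_(r < R) Fr r A in
  let obj : {ffun V -> K} -> K :=
    fun x => lovasz F x + 2^-1 * enorm x ^+ 2 in
  exists astar bstar : {ffun 'I_R * V -> K},
    [/\ enorm (a k - astar) @[k --> \oo] --> (0 : K),
        enorm (b k - bstar) @[k --> \oo] --> (0 : K),
        [/\ sum_zero_space astar, prod_base Fr bstar &
            forall a' b' : {ffun 'I_R * V -> K},
              sum_zero_space a' -> prod_base Fr b' ->
              enorm (astar - bstar) ^+ 2 <= enorm (a' - b') ^+ 2] &
        exists C : K, forall k : nat,
          `|obj (Gamma (b k)) - obj (Gamma bstar)|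
            <= C * (1 - 1 / (N%:R ^+ 2 * R%:R ^+ 2)) ^+ k].
Proof.
move=> F obj.
have n1 : 1 <= N%:R :> K by rewrite ler1n.
have r1 : 1 <= R%:R :> K by rewrite ler1n.
have Bb k : prod_base Fr (b k) := (hb k).1.
have aE k : a k.+1 = b k - spread (block_sum (b k)).
  exact: is_proj_sum_zero (ha k).
have [c Bc cmin] := ex_min_block_sum (ex_intro _ _ (Bb 0%N)).
(* This is the block sum of the limit of [b], and [Gamma] maps that limit to
   [- s]. *)
pose s := block_sum c.
have Hc : fiber Fr s c by split.
have /choice[h hP] k : exists h, is_proj (fiber Fr s) (b k) h.
  by apply: ex_proj_fiber; exists c.
have step k : is_proj (prod_base Fr) (b k - spread (block_sum (b k))) (b k.+1).
  by rewrite -aE.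
set rho : K := 1 - _.
have q1 : 1 <= N%:R ^+ 2 * R%:R ^+ 2 :> K.
  by rewrite mulr_ege1// exprn_ege1.
have rho0 : 0 <= rho.
  by rewrite subr_ge0 ler_pdivrMr ?mul1r// (lt_le_trans ltr01).
have rho1 : rho < 1.
  by rewrite ltrBlDr ltrDl divr_gt0// (lt_le_trans ltr01).
pose E := enorm (b 0%N - h 0%N).
have E0 : 0 <= E := enorm_ge0 _.
have bh k : enorm (b k - h k) <= E * rho ^+ k.
  elim: k => [|k IHk]; first by rewrite expr0 mulr1.
  apply: (@le_trans _ _ (rho * enorm (b k - h k))); last first.
    by rewrite exprS mulrCA ler_wpM2l.
  rewrite -(ler_pXn2r (_ : 0 < 2)%N) ?nnegrE ?mulr_ge0 ?enorm_ge0//.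
  rewrite exprMn !enorm_sqr /rho -hV.
  apply: (alternating_step_contraction hR cmin (Bb k) (step k)) => //.
  by rewrite hV.
have bmh m k : (k <= m)%N -> enorm (b m - h k) <= E * rho ^+ k.
  move=> /subnK <-; elim: (m - k)%N => [|j IHj]; first exact: bh.
  apply: le_trans IHj; rewrite enorm_le addSn.
  apply: le_trans (alternating_step_fejer hR cmin (step _) (hP k).1) _.
  by rewrite gerBl divr_ge0// dot_ge0.
have coord (x : {ffun 'I_R * V -> K}) e : enorm x <= e -> forall p, `|x p| <= e.
  by move=> xe p; exact: le_trans (coord_le_enorm x p) xe.
(* The projections [h k] stay in the fiber and form a Cauchy sequence, because all
   later [b m] are near [h k]; their limit is the limit of [b] too. *)
have /choice[l0 hl] p : exists l, forall k, `|h k p - l| <= 2 * E * rho ^+ k.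
  apply: geometric_cauchy_limit => // m k km.
  have := coord _ _ (bmh _ _ km) p.
  have := coord _ _ (bh m) p; rewrite !ffunE.
  have : E * rho ^+ m <= E * rho ^+ k by rewrite ler_wpM2l// ler_wiXn2l// ltW.
  by rewrite !ler_norml => ? /andP[? ?] /andP[? ?]; apply/andP; split; lra.
pose l : {ffun 'I_R * V -> K} := finfun l0.
have Hl : fiber Fr s l.
  apply: (@fiber_cvg _ _ _ _ _ h) => [k|p]; first exact: (hP k).1.
  apply/subr_cvg0; apply: norm_cvg0.
  apply: (squeeze_geometric rho0 rho1 (c := 2 * E)) => k.
  by rewrite normr_ge0 /= ffunE hl.
have bl k : enorm (b k - l) <= #|{: 'I_R * V}|%:R * (3 * E * rho ^+ k).
  apply: enorm_le_coord => p.
  have := coord _ _ (bh k) p; have := hl p k; rewrite !ffunE.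
  by rewrite !ler_norml => /andP[? ?] /andP[? ?]; apply/andP; split; lra.
exists (l - spread s), l; split.
- rewrite -cvg_shiftS.
  apply: (squeeze_geometric rho0 rho1
    (c := #|{: 'I_R * V}|%:R * (3 * E))) => k.
  rewrite enorm_ge0 -mulrA (le_trans _ (bl k))// enorm_le aE.
  have -> : b k - spread (block_sum (b k)) - (l - spread s) =
      (b k - l) - spread (block_sum (b k - l)).
    by rewrite block_sumB Hl.2 spreadB; apply/ffunP => p; rewrite !ffunE; ring.
  by rewrite (dot_sub_spread hR) gerBl divr_ge0// dot_ge0.
- apply: (squeeze_geometric rho0 rho1
    (c := #|{: 'I_R * V}|%:R * (3 * E))) => k.
  by rewrite enorm_ge0 -mulrA bl.
- split; [|exact: Hl.1|move=> a' b' a'0 Bb'].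
    by rewrite /sum_zero_space /= -/(block_sum _) block_sumB block_sum_spread// Hl.2 subrr.
  rewrite !enorm_sqr; apply: le_trans (dot_block_sum_le hR _).
  rewrite addrAC subrr sub0r dotNl dotNr opprK dot_spread block_sum_spread//.
  rewrite block_sumB [block_sum a']a'0 sub0r dotNl dotNr opprK.
  rewrite ler_wpM2r ?invr_ge0//.
  have := cmin _ Bb'; rewrite -/s; have := dot_ge0 (block_sum b' - s).
  by rewrite !dotE (dotC _ s); lra.
have GE w : Gamma w = - block_sum w by [].
exists (2 * base_bound F * (N%:R * (R%:R * E))) => k.
rewrite !GE; apply: le_trans (objective_lipschitz (L := base_bound F) _ _ _) _.
- by move=> t Ft v; exact: base_polytope_bounded.
- by rewrite opprK; exact: block_sum_base.
- by rewrite opprK; apply: block_sum_base; exact: Hl.1.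
rewrite -[X in _ <= X]mulrA; apply: ler_wpM2l.
  by do 2!apply: mulr_ge0 => //; apply: sumr_ge0.
apply: (@le_trans _ _ (\sum_(v : V) R%:R * (E * rho ^+ k))).
  apply: ler_sum => v _; rewrite !ffunE opprK.
  have -> : - block_sum (b k) v + block_sum l v =
      - block_sum (b k - h k) v.
    by rewrite block_sumB Hl.2 (hP k).1.2 !ffunE opprB addrC.
  rewrite normrN block_sumE; apply: le_trans (ler_norm_sum _ _ _) _.
  apply: (@le_trans _ _ (\sum_(r < R) (E * rho ^+ k))).
    by apply: ler_sum => r _; exact: coord.
  by rewrite sumr_const card_ord -[_ *+ _]mulr_natl.
by rewrite sumr_const -[_ *+ _]mulr_natl hV !mulrA.
Qed.
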